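(* Suppose that $S\subset\mathbb{R}^d$ has the generic intersection property. Consider nonzero vectors $a_1,\dots,a_n\in\mathbb{R}^d$ and write $X=a_1\xi_1+\dots+a_n\xi_n$, where $\xi_1,\dots,\xi_n$ are i.i.d. Rademacher random variables. Then there is a constant $C_S$ depending only on $S$ such that: (1) $\Pr(X\in S)\le C_S n^{-1/2}$, and (2) $\Pr(X\in S)\le C_S\rho^{1/(d+1)}$, where $\rho=\max_{x\in\mathbb{R}^d}\Pr(X=x)$.
   Context: A Rademacher random variable takes the values $1$ and $-1$ each with probability $1/2$. A set $S\subseteq\mathbb{R}^d$ has the generic intersection property if there is $D\in\mathbb{N}$ such that for every affine subspace $\Lambda\subseteq\mathbb{R}^d$ (including $\Lambda=\mathbb{R}^d$) and any distinct $x_1,\dots,x_{\dim\Lambda}\in\mathbb{R}^d$, we have $\left|\bigcap_{i=1}^{\dim\Lambda}\big((S\cap\Lambda)-x_i\big)\right|\le D$. *)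

(* Defs.v *)
From HB Require Import structures.
From mathcomp Require Import all_boot all_order all_algebra.
From mathcomp Require Import all_classical all_reals all_analysis.

Set Implicit Arguments.
Unset Strict Implicit.
Unset Printing Implicit Defensive.

Import Order.TTheory GRing.Theory Num.Theory.
Local Open Scope classical_set_scope.
Local Open Scope ring_scope.

(* The affine subspace through p with direction V; its dimension is \dim V. *)
Definition affine_subspace (R : realType) (d : nat)
    (p : 'rV[R]_d) (V : {vspace 'rV[R]_d}) : set 'rV[R]_d :=
  [set x | x - p \in V].

(* Zero-dimensional subspaces are left out: for them the family x is empty.  An
   empty intersection taken in the whole space would make the property false
   for all d > 0, and taken inside the subspace it has exactly one point. *)
Definition generic_intersection (R : realType) (d : nat)
    (S : set 'rV[R]_d) : Prop :=
  exists D : nat, forall (p : 'rV[R]_d) (V : {vspace 'rV[R]_d}),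
    (0 < \dim V)%N ->
    forall x : 'I_(\dim V) -> 'rV[R]_d, injective x ->
      (\bigcap_i [set s - x i | s in S `&` affine_subspace p V] #<= `I_D)%card.

(* Requiring the values 1 and -1 everywhere, not just almost surely, makes the
   event that a signed sum of such variables lies in S measurable for every set
   S, Borel or not. *)
Definition rademacher (dsp : measure_display) (T : measurableType dsp)
    (R : realType) (P : probability T R) (X : {RV P >-> R}) : Prop :=
  [/\ forall t, X t = 1 \/ X t = -1,
      P [set t | X t = 1] = (2^-1)%:E
    & P [set t | X t = -1] = (2^-1)%:E].

Definition mutually_independent (dsp : measure_display)
    (T : measurableType dsp) (R : realType) (P : probability T R)
    (I : finType) (X : I -> {RV P >-> R}) : Prop :=
  forall (J : {set I}) (B : I -> set R), (forall i, measurable (B i)) ->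
    P (\bigcap_(i in [set` J]) (X i @^-1` B i)) =
    (\prod_(i in J) P (X i @^-1` B i))%E.

Definition rv_comb (dsp : measure_display) (T : measurableType dsp)
    (R : realType) (P : probability T R) (d n : nat)
    (a : 'I_n -> 'rV[R]_d) (xi : 'I_n -> {RV P >-> R}) (t : T) : 'rV[R]_d :=
  \sum_(i < n) xi i t *: a i.

Definition is_maximum (R : realType) (A : set (\bar R)) (m : \bar R) : Prop :=
  A m /\ ubound A m.

(* Main.v *)
(* Split X as Y + Z. If S has few points in the intersection of k distinct
   translates, expanding the k-th moment of P(Y + z \in S) over collision-free
   k-tuples of copies of Y shows P(X \in S) = O(delta + eta^(1/k)), where delta
   and eta bound the atoms of Y and Z.

   For (2), take k = d and let Y be the shortest initial partial sum whose atoms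
   are at most r = rho^(1/(d+1)): its largest atom is at least r/2, hence the
   atoms of Z are at most 2 rho / r = 2 r^d.

   For (1), let k be the dimension of the span. Either the vectors contain two
   families of m disjoint bases each, with m of order n, and assigning one family
   to Y and the other to Z gives delta, eta = O(m^(-k/2)); or half of the vectors
   span a smaller subspace, and one conditions on the signs of the others and
   inducts on k, which is why S is intersected with
   affine subspaces. The bound O(m^(-k/2)) of Halasz needs no Fourier analysis
   when m is a power of 2: repeated Cauchy-Schwarz bounds the atoms of a sum of m
   independent symmetric variables by the largest of the return probabilities
   at 0 of m copies of one of them, and for a basis these factor into central
   binomial probabilities. *)

Require Import Defs.
From mathcomp Require Import all_boot all_order all_algebra.
From mathcomp Require Import all_classical all_reals all_analysis.
From mathcomp Require Import ring lra zify.

Import Order.TTheory GRing.Theory Num.Theory.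
Local Open Scope classical_set_scope.
Local Open Scope ring_scope.

(** * Averages over independent signs *)

(* Expectation of f at the sum of the vectors of L with independent uniform signs. *)
Fixpoint rmean (R : realType) (V : zmodType) (L : seq V) (f : V -> R) : R :=
  if L is a :: L' then
    (rmean R V L' (fun x => f (x + a)) + rmean R V L' (fun x => f (x - a))) / 2
  else f 0.
Arguments rmean {R V} L f.

Definition pmass {R : realType} {V : zmodType} (L : seq V) (x : V) : R :=
  rmean L (fun y => (y == x)%:R).

Lemma eq_rmean (R : realType) (V : zmodType) (L : seq V) (f g : V -> R) :
  f =1 g -> rmean L f = rmean L g.
Proof. by move=> /funext ->. Qed.

Lemma rmeanD (R : realType) (V : zmodType) (L : seq V) (f g : V -> R) :
  rmean L (fun x => f x + g x) = rmean L f + rmean L g.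
Proof. by elim: L f g => //= a L IH f g; rewrite !IH; field. Qed.

Lemma rmeanZ (R : realType) (V : zmodType) (L : seq V) (c : R) (f : V -> R) :
  rmean L (fun x => c * f x) = c * rmean L f.
Proof. by elim: L f => //= a L IH f; rewrite !IH; field. Qed.

Lemma rmean_cst (R : realType) (V : zmodType) (L : seq V) (c : R) :
  rmean L (fun=> c) = c.
Proof. by elim: L => //= a L ->; field. Qed.

Lemma rmean_sum (R : realType) (V : zmodType) (I : Type) (r : seq I)
    (P : pred I) (L : seq V) (F : I -> V -> R) :
  rmean L (fun x => \sum_(i <- r | P i) F i x) =
  \sum_(i <- r | P i) rmean L (F i).
Proof.
elim: r => [|i r IH].
  by rewrite big_nil -[RHS](rmean_cst _ _ L); apply: eq_rmean => x; rewrite big_nil.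
rewrite big_cons -IH; case: ifPn => Pi.
  by rewrite -rmeanD; apply: eq_rmean => x; rewrite big_cons Pi.
by apply: eq_rmean => x; rewrite big_cons (negPf Pi).
Qed.

Lemma le_rmean (R : realType) (V : zmodType) (L : seq V) (f g : V -> R) :
  (forall x, f x <= g x) -> rmean L f <= rmean L g.
Proof.
elim: L f g => [|a L IH] f g fg /=; first exact: fg.
by rewrite ler_pM2r ?invr_gt0 ?ltr0n // lerD ?IH.
Qed.

Lemma rmean_ge0 (R : realType) (V : zmodType) (L : seq V) (f : V -> R) :
  (forall x, 0 <= f x) -> 0 <= rmean L f.
Proof. by move=> f0; rewrite -(rmean_cst R V L 0); exact: le_rmean. Qed.

Lemma rmean_exchange (R : realType) (V : zmodType) (L M : seq V)
    (f : V -> V -> R) :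
  rmean L (fun x => rmean M (f x)) = rmean M (fun y => rmean L (fun x => f x y)).
Proof.
elim: L f => //= a L IH f; rewrite !IH -rmeanD mulrC -rmeanZ.
by apply: eq_rmean => y; rewrite mulrC.
Qed.

Lemma rmean_cat (R : realType) (V : zmodType) (L M : seq V) (f : V -> R) :
  rmean (L ++ M) f = rmean L (fun x => rmean M (fun y => f (x + y))).
Proof.
elim: L f => [|a L IH] f /=; first by apply: eq_rmean => y; rewrite add0r.
by rewrite !IH; congr ((_ + _) / _); apply: eq_rmean => x; apply: eq_rmean => y;
  rewrite addrAC.
Qed.

Lemma rmean_catC (R : realType) (V : zmodType) (L M : seq V) (f : V -> R) :
  rmean (L ++ M) f = rmean (M ++ L) f.
Proof.
rewrite !rmean_cat rmean_exchange.
by apply: eq_rmean => y; apply: eq_rmean => x; rewrite addrC.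
Qed.

Lemma perm_rmean (R : realType) (V : zmodType) (L M : seq V) (f : V -> R) :
  perm_eq L M -> rmean L f = rmean M f.
Proof.
elim: L M f => [|a L IH] M f; first by rewrite perm_sym => /perm_nilP ->.
move=> pLM; have : a \in M by rewrite -(perm_mem pLM) mem_head.
move=> /path.splitPr aM; case: aM pLM => M1 M2.
rewrite perm_sym -cat1s perm_catCA perm_cons perm_catC perm_sym => pL.
by rewrite rmean_catC /= !(IH _ _ pL).
Qed.

Lemma rmeanN (R : realType) (V : zmodType) (L : seq V) (f : V -> R) :
  rmean L (fun x => f (- x)) = rmean L f.
Proof.
elim: L f => [|a L IH] f /=; first by rewrite oppr0.
rewrite addrC; congr (_ / _); congr (_ + _); rewrite -[RHS]IH;
  by apply: eq_rmean => x; congr f; rewrite opprD ?opprK.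
Qed.

(** A signed sum takes finitely many values. Listing them in [U] lets a mean be expanded as a finite
    sum over atoms. *)
Lemma rmean_supp (R : realType) (V : zmodType) (L : seq V) :
  exists U : seq V, uniq U /\
    forall f g : V -> R, {in U, f =1 g} -> rmean L f = rmean L g.
Proof.
elim: L => [|a L [U [_ UL]]].
  by exists [:: 0]; split=> // f g fg; apply: fg; rewrite mem_head.
exists (undup (map (+%R^~ a) U ++ map (fun x => x - a) U)).
split=> [|f g fg]; first exact: undup_uniq.
rewrite /=; congr ((_ + _) / _); apply: UL => x xU; apply: fg;
  rewrite mem_undup mem_cat; apply/orP; [left | right]; apply/mapP; by exists x.
Qed.

Lemma rmean_span (R : realType) (V : vectType R) (W : {vspace V}) (L : seq V)
    (f g : V -> R) :
  {subset L <= W} -> {in W, f =1 g} -> rmean L f = rmean L g.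
Proof.
elim: L f g => [|a L IH] f g LW fg /=; first by apply: fg; rewrite mem0v.
have aW : a \in W by apply: LW; rewrite mem_head.
have LW' : {subset L <= W} by move=> x xL; apply: LW; rewrite inE xL orbT.
by congr ((_ + _) / _); apply: IH => // x xW; apply: fg;
  rewrite ?rpredB ?rpredD.
Qed.

(** * Atoms of signed sums *)

Lemma pmass_ge0 (R : realType) (V : zmodType) (L : seq V) (x : V) :
  0 <= pmass L x :> R.
Proof. by apply: rmean_ge0 => y; exact: ler0n. Qed.

Lemma pmass_cat (R : realType) (V : zmodType) (L M : seq V) (x : V) :
  pmass (L ++ M) x = rmean L (fun y => pmass M (x - y)) :> R.
Proof.
rewrite /pmass rmean_cat; apply: eq_rmean => y; apply: eq_rmean => z.
by rewrite [x - y]/(_ + _) [in RHS]eq_sym subr_eq eq_sym addrC.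
Qed.

Lemma perm_pmass (R : realType) (V : zmodType) (L M : seq V) (x : V) :
  perm_eq L M -> pmass L x = pmass M x :> R.
Proof. exact: perm_rmean. Qed.

(** * Cauchy-Schwarz and return probabilities *)

(* The squares sum to the probability that two independent copies agree, and by
   symmetry their difference is distributed as the signed sum of L ++ L. *)
Lemma sum_pmass_sqr_le (R : realType) (V : zmodType) (L U : seq V) :
  uniq U -> \sum_(u <- U) pmass L u ^+ 2 <= pmass (L ++ L) 0 :> R.
Proof.
move=> uU; rewrite pmass_cat.
rewrite [leRHS](_ : _ = rmean L (fun y => pmass L y)); last first.
  by rewrite -[RHS]rmeanN; apply: eq_rmean => y; rewrite sub0r.
rewrite (eq_bigr (fun u => rmean L (fun y => pmass L u * (y == u)%:R))).
  rewrite -rmean_sum; apply: le_rmean => y.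
  have [yU|yU] := boolP (y \in U).
    rewrite (bigD1_seq y) //= eqxx mulr1 big1 ?addr0 // => u.
    by rewrite eq_sym => /negPf ->; rewrite mulr0.
  rewrite big1_seq ?pmass_ge0 // => u /= uin.
  by case: eqP uin yU => [-> ->//|]; rewrite mulr0.
by move=> u _; rewrite expr2 rmeanZ.
Qed.

(** The convolution sum is split by [2ab <= a^2 + b^2] instead of Cauchy-Schwarz proper: no square
    roots appear, and an average is enough when both halves obey the same bound. *)
Lemma pmass_cat_avg (R : realType) (V : zmodType) (A B : seq V) (x : V) :
  pmass (A ++ B) x <= (pmass (A ++ A) 0 + pmass (B ++ B) 0) / 2 :> R.
Proof.
rewrite pmass_cat; have [U [uU UA]] := rmean_supp R V A.
rewrite (UA _ (fun y => \sum_(u <- U) pmass B (x - u) * (y == u)%:R)); last first.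
  move=> y yU; rewrite (bigD1_seq y) //= eqxx mulr1 big1 ?addr0 // => u.
  by rewrite eq_sym => /negPf ->; rewrite mulr0.
rewrite rmean_sum.
apply: le_trans (_ : (\sum_(u <- U) pmass A u ^+ 2 +
    \sum_(u <- map (fun u => x - u) U) pmass B u ^+ 2) / 2 <= _); last first.
  rewrite ler_pM2r ?invr_gt0 ?ltr0n // lerD ?sum_pmass_sqr_le //.
  by rewrite map_inj_uniq // => u v /addrI /oppr_inj.
rewrite big_map -big_split mulr_suml ler_sum // => u _; rewrite rmeanZ -/(pmass A u).
by have := sqr_ge0 (pmass A u - pmass B (x - u) : R); rewrite /=; nra.
Qed.

Lemma perm_flatten_double (T : eqType) (Ls : seq (seq T)) :
  perm_eq (flatten Ls ++ flatten Ls) (flatten (map (fun L => L ++ L) Ls)).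
Proof.
elim: Ls => //= L Ls IH; rewrite -!catA perm_cat2l perm_sym.
by apply: perm_trans (_ : perm_eq _ (L ++ (flatten Ls ++ flatten Ls))) _;
  rewrite ?perm_cat2l ?[perm_eq _ (flatten _ ++ flatten _)]perm_sym // perm_catCA.
Qed.

Lemma flatten_nseq_double (T : Type) (m : nat) (L : seq T) :
  flatten (nseq m (L ++ L)) = flatten (nseq (m + m) L).
Proof. by elim: m => //= m ->; rewrite addnS /= catA. Qed.

(** Each half of [Ls] gets replaced by two copies of itself, which regroup into half as many blocks,
    each doubled. The induction ends with copies of a single block. *)
Lemma pmass_flatten_le (R : realType) (V : zmodType) (s : nat)
    (Ls : seq (seq V)) (q : R) (x : V) :
  size Ls = (2 ^ s.+1)%N ->
  {in Ls, forall L, pmass (flatten (nseq (2 ^ s.+1) L)) 0 <= q} ->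
  pmass (flatten Ls) x <= q.
Proof.
elim: s Ls x => [|s IH] Ls x sLs Lq.
  case: Ls sLs Lq => [|A [|B []]] //= _ Lq; rewrite cats0.
  apply: le_trans (pmass_cat_avg _ _ _ _ _) _.
  have := Lq A (mem_head _ _); have := Lq B (mem_last _ [:: B]).
  by rewrite /= !cats0 => Bq Aq; lra.
rewrite -(cat_take_drop (2 ^ s.+1) Ls) flatten_cat.
apply: le_trans (pmass_cat_avg _ _ _ _ _) _.
have half (Ms : seq (seq V)) : size Ms = (2 ^ s.+1)%N -> {subset Ms <= Ls} ->
    pmass (flatten Ms ++ flatten Ms) 0 <= q.
  move=> sMs MsLs; rewrite (perm_pmass _ _ _ _ _ (perm_flatten_double _ _)).
  apply: IH; rewrite ?size_map // => _ /mapP [L LMs ->].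
  by rewrite flatten_nseq_double addnn -mul2n -expnS; apply/Lq/MsLs.
have sz : size Ls = (2 ^ s.+1 + 2 ^ s.+1)%N by rewrite sLs addnn -mul2n -expnS.
have lt_sz : (2 ^ s.+1 < 2 ^ s.+1 + 2 ^ s.+1)%N.
  by rewrite -[ltnLHS]addn0 ltn_add2l expn_gt0.
have tq : pmass (flatten (take (2 ^ s.+1) Ls) ++ flatten (take (2 ^ s.+1) Ls)) 0 <= q.
  by apply: half => [|L]; [rewrite size_take sz lt_sz | exact: mem_take].
have dq : pmass (flatten (drop (2 ^ s.+1) Ls) ++ flatten (drop (2 ^ s.+1) Ls)) 0 <= q.
  by apply: half => [|L]; [rewrite size_drop sz addnK | exact: mem_drop].
lra.
Qed.

(** * Central binomial probabilities *)

(** Consecutive central binomials have ratio [2(2r+1)/(r+1)], so the induction reduces to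
    [(2r+3)(2r+1) <= (2r+2)^2]. *)
Lemma central_binomial_sqr_le (r : nat) :
  (r.*2.+1 * 'C(r.*2, r) ^ 2 <= (2 ^ r.*2) ^ 2)%N.
Proof.
elim: r => [//|r IH].
have e1 : (r.+1 * 'C(r.*2.+2, r.+1) = r.*2.+2 * 'C(r.*2.+1, r))%N.
  by rewrite -mul_bin_diag.
have e2 : (r.+1 * 'C(r.*2.+1, r) = r.*2.+1 * 'C(r.*2, r))%N.
  have := mul_bin_down r.*2.+1 r; rewrite /= => ->.
  by congr (_ * _)%N; rewrite -addnn -addSn addnK.
have e : (r.+1 * 'C(r.*2.+2, r.+1) = 2 * (r.*2.+1 * 'C(r.*2, r)))%N.
  by rewrite e1 -e2; lia.
rewrite doubleS -(@leq_pmul2l (r.+1 ^ 2)) ?expn_gt0 //.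
set b := 'C(_, r) in IH e; set c := 'C(_, r.+1) in e *.
have -> : (r.+1 ^ 2 * (r.*2.+3 * c ^ 2) = r.*2.+3 * (2 * (r.*2.+1 * b)) ^ 2)%N.
  by rewrite -e expnMn mulnCA.
have -> : (r.+1 ^ 2 * (2 ^ r.*2.+2) ^ 2 = 16 * r.+1 ^ 2 * (2 ^ r.*2) ^ 2)%N.
  by rewrite (expnS 2) (expnS 2); ring.
apply: leq_trans (_ : 16 * r.+1 ^ 2 * (r.*2.+1 * b ^ 2) <= _)%N; last first.
  by rewrite leq_mul2l IH orbT.
have : (4 * (r.*2.+3 * r.*2.+1) <= 16 * r.+1 ^ 2)%N by rewrite -muln2 !expnS expn0; nia.
move=> /(leq_mul (leqnn (r.*2.+1 * b ^ 2))); rewrite [leqRHS]mulnC.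
by apply: leq_trans; rewrite leq_eqVlt; apply/orP; left; apply/eqP; ring.
Qed.

(** The binomial law, with [i] counting the plus signs; the induction is Pascal's rule. *)
Lemma rmean_nseq (R : realType) (V : zmodType) (m : nat) (a : V) (f : V -> R) :
  rmean (nseq m a) f =
  (\sum_(i < m.+1) 'C(m, i)%:R * f (a *+ i - a *+ (m - i))) / 2 ^+ m.
Proof.
elim: m f => [|m IH] f; first by rewrite big_ord1 /= subrr bin0 expr0 mul1r divr1.
rewrite /= !IH -mulrDl exprSr invfM mulrA; congr (_ / _ / _).
rewrite [in RHS]big_ord_recl [X in _ = X + _]/= bin0 subn0.
rewrite [X in _ = _ + X](eq_bigr (fun i : 'I_m.+1 =>
   'C(m, i)%:R * f (a *+ i.+1 - a *+ (m - i)) +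
   'C(m, i.+1)%:R * f (a *+ i.+1 - a *+ (m - i)))); last first.
  by move=> i _; rewrite /= /bump /= add1n subSS binS natrD addrC mulrDl.
rewrite big_split /= addrCA; congr (_ + _).
  apply: eq_bigr => i _; congr (_ * f _).
  by rewrite mulrSr addrAC.
rewrite big_ord_recl [in RHS]big_ord_recr /= (bin_small (ltnSn m)) mul0r addr0.
rewrite bin0 subn0; congr (_ * f _ + _).
  by rewrite mulr0n !sub0r mulrS opprD addrC.
apply: eq_bigr => i _; congr (_ * f _); rewrite /bump /= add1n.
by rewrite -addrA -opprD -mulrSr -subSn // ?subSS.
Qed.

Lemma pmass_nseq_sqr_le (R : realType) (V : lmodType R) (r : nat) (a : V) :
  a != 0 -> pmass (nseq r.*2 a) 0 ^+ 2 <= (r.*2.+1%:R)^-1 :> R.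
Proof.
move=> a0; rewrite /pmass rmean_nseq.
have rlt : (r < r.*2.+1)%N by lia.
have rB : (r.*2 - r)%N = r by lia.
rewrite (bigD1 (Ordinal rlt)) //= rB subrr eqxx mulr1.
rewrite big1 ?addr0 => [|i ir]; last first.
  rewrite -[a *+ i]scaler_nat -[a *+ (_ - i)]scaler_nat -scalerBl.
  rewrite scaler_eq0 (negPf a0) orbF.
  rewrite subr_eq0 eqr_nat; case: eqP => [e|]; last by rewrite mulr0.
  by case/negP: ir; apply/eqP/val_inj => /=; have := ltn_ord i; lia.
have := central_binomial_sqr_le r; rewrite -(ler_nat R) natrM !natrX => le_r.
rewrite expr_div_n ler_pdivrMr ?exprn_gt0 // ler_pdivlMl ?ltr0n //.
Qed.

(** * Sums of many bases *)

Lemma perm_flatten_nseq (T : eqType) (m : nat) (B : seq T) :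
  perm_eq (flatten (nseq m B)) (flatten (map (nseq m) B)).
Proof.
elim: m => [|m IH] /=; first by elim: B.
apply: perm_trans (_ : perm_eq _ (B ++ flatten (map (nseq m) B))) _.
  by rewrite perm_cat2l.
elim: B {IH} => //= b B IH; rewrite perm_cons.
by apply: perm_trans (_ : perm_eq _ (nseq m b ++ (B ++ flatten (map (nseq m) B)))) _;
  rewrite ?perm_cat2l // perm_catCA.
Qed.

(* For independent vectors, the sum returns to 0 only if each coordinate does. *)
Lemma pmass_flatten_free (R : realType) (V : vectType R) (m : nat)
    (B : seq V) (q : R) :
  free B -> {in B, forall b, pmass (nseq m b) 0 <= q} ->
  pmass (flatten (map (nseq m) B)) 0 <= q ^+ size B.
Proof.
elim: B => [|b B IH] fB Bq /=.
  by rewrite expr0 /pmass /= eqxx.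
move: fB; rewrite free_cons => /andP[bB fB].
have -> : pmass (nseq m b ++ flatten (map (nseq m) B)) 0 =
    pmass (nseq m b) 0 * pmass (flatten (map (nseq m) B)) 0 :> R.
  rewrite pmass_cat mulrC -rmeanZ.
  apply: (rmean_span _ _ <[b]>%VS) => [x|y yb].
    by rewrite mem_nseq => /andP[_ /eqP ->]; exact: memv_line.
  rewrite sub0r mulrC -rmeanZ.
  apply: (rmean_span _ _ <<B>>%VS) => [x /flattenP [_ /mapP [c cB ->]]|z zB].
    by rewrite mem_nseq => /andP[_ /eqP ->]; exact: memv_span.
  have [->|y0] := eqVneq y 0; first by rewrite oppr0 mul1r.
  rewrite mul0r; case: eqP => // zy; case/negP: bB; move: y0 zB.
  case/vlineP: yb zy => c -> ->; rewrite memvN => c0 cB.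
  move: c0; rewrite scaler_eq0 negb_or => /andP[c0 _].
  by rewrite -[b]scale1r -(mulVf c0) -scalerA; exact: memvZ.
by rewrite exprS ler_pM ?pmass_ge0 ?IH ?Bq ?mem_head // => c cB;
  rewrite Bq // inE cB orbT.
Qed.

(** [lam] is any upper bound for [2^(-(s+1)/2)]; each of the [k] vectors of a repeated basis
    contributes one factor [lam]. *)
Lemma pmass_flatten_bases (R : realType) (V : vectType R) (k s : nat)
    (Bs : seq (seq V)) (x : V) (lam : R) :
  size Bs = (2 ^ s.+1)%N -> {in Bs, forall B, free B /\ size B = k} ->
  0 <= lam -> ((2 ^ s.+1)%:R)^-1 <= lam ^+ 2 -> pmass (flatten Bs) x <= lam ^+ k.
Proof.
move=> sBs fBs lam0 slam; apply: (pmass_flatten_le _ _ s) => // B BBs.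
have [fB <-] := fBs _ BBs.
rewrite (perm_pmass _ _ _ _ _ (perm_flatten_nseq _ _ _)).
apply: pmass_flatten_free => // b bB.
rewrite -(ler_pXn2r (n:=2)) ?nnegrE ?pmass_ge0 //.
have b0 : b != 0.
  by apply: contraTneq fB => b0; rewrite (perm_free (perm_to_rem bB)) free_cons b0 mem0v.
rewrite expnS mul2n; apply: le_trans (pmass_nseq_sqr_le _ _ _ _ b0) _.
apply: le_trans slam; rewrite expnS mul2n lef_pV2 ?posrE ?ltr0n ?ler_nat //.
by rewrite double_gt0 expn_gt0.
Qed.

(** * Extraction of disjoint bases *)

Lemma perm_free_span (R : realType) (V : vectType R) (L : seq V) :
  exists B M, [/\ perm_eq L (B ++ M), free B & <<B>>%VS = <<L>>%VS].
Proof.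
elim: L => [|a L [B [M [pL fB sB]]]]; first by exists [::], [::]; rewrite nil_free.
have [aB|aB] := boolP (a \in <<B>>%VS).
  exists B, (a :: M); split=> //.
    by rewrite perm_sym -cat1s perm_catCA perm_cons perm_sym.
  by rewrite span_cons -sB; apply/esym/addv_idPr; rewrite -memvE.
exists (a :: B), M; split; rewrite ?perm_cons ?free_cons ?aB //.
by rewrite !span_cons sB.
Qed.

(** Bases of the span are peeled off while the remainder still has rank [k]. If the rank drops
    within [m] removals, at most [m * k] vectors have been used. *)
Lemma perm_bases_or_low_dim (R : realType) (V : vectType R) (k m : nat)
    (L : seq V) :
  \dim <<L>> = k ->
  (exists Bs M, [/\ perm_eq L (flatten Bs ++ M), size Bs = m &
     {in Bs, forall B, free B /\ size B = k}]) \/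
  (exists M N, [/\ perm_eq L (M ++ N), (size M <= m * k)%N &
     (\dim <<N>> < k)%N]).
Proof.
elim: m L => [|m IH] L dL; first by left; exists [::], L.
have [B [M [pL fB sB]]] := perm_free_span R V L.
have szB : size B = k by rewrite -dL -sB; apply/esym/eqP.
have : (\dim << M >> <= k)%N.
  by rewrite -dL (eq_span (perm_mem pL)) span_cat dimvS // addvSr.
rewrite leq_eqVlt => /orP[/eqP dM|dM]; last first.
  by right; exists B, M; rewrite szB mulSn leq_addr.
have [[Bs [N [pM sBs hBs]]]|[M' [N [pM sM' dN]]]] := IH _ dM; [left|right].
  exists (B :: Bs), N; split; rewrite /= ?sBs //.
    by apply: perm_trans pL _; rewrite -catA perm_cat2l.
  by move=> B' /[!inE] /orP[/eqP ->//|]; exact: hBs.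
exists (B ++ M'), N; split => //; last by rewrite size_cat mulSn szB leq_add2l.
by apply: perm_trans pL _; rewrite -catA perm_cat2l.
Qed.

(** * Counting with distinct copies *)

(* The k-th moment of P(y \in A) restricted to collision-free tuples: k independent
   copies all lie in A, are pairwise distinct and avoid xs. *)
Fixpoint distinct_mean (R : realType) (V : zmodType) (L : seq V)
    (A : pred V) (k : nat) (xs : seq V) : R :=
  if k is k'.+1 then
    rmean L (fun y => ((y \notin xs) && A y)%:R *
                      distinct_mean R V L A k' (y :: xs))
  else 1.
Arguments distinct_mean {R V} L A k xs.

Lemma distinct_mean_ge0 (R : realType) (V : zmodType) (L : seq V)
    (A : pred V) (k : nat) (xs : seq V) :
  0 <= distinct_mean L A k xs :> R.
Proof.
elim: k xs => //= k IH xs; apply: rmean_ge0 => y.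
by rewrite mulr_ge0.
Qed.

(** Avoiding the points already chosen costs at most [delta] each, so every factor is at least [t].
    The quantity [size xs + k] is constant along the recursion. *)
Lemma distinct_mean_ge (R : realType) (V : zmodType) (L : seq V)
    (A : pred V) (k : nat) (xs : seq V) (delta t : R) :
  (forall x, pmass L x <= delta) -> 0 <= t ->
  t + (size xs + k)%:R * delta <= rmean L (fun y => (A y)%:R) ->
  t ^+ k <= distinct_mean L A k xs.
Proof.
move=> Ld t0; elim: k xs => [|k IH] xs tp //=.
have d0 : 0 <= delta := le_trans (pmass_ge0 _ _ L 0) (Ld 0).
apply: le_trans (_ : rmean L (fun y => t ^+ k * ((y \notin xs) && A y)%:R) <= _).
  rewrite rmeanZ exprSr ler_wpM2l ?exprn_ge0 //.
  apply: le_trans (_ : rmean L (fun y => (A y)%:R + (-1) *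
      \sum_(x <- xs) (y == x)%:R) <= _); last first.
    apply: le_rmean => y; have [yxs|yxs] /= := boolP (y \in xs).
      rewrite (big_rem y) //= eqxx mulN1r opprD addrA.
      rewrite -[leRHS]addr0 lerD //; first by case: (A y); rewrite ?subrr ?sub0r ?lerN10.
      by rewrite oppr_le0 sumr_ge0.
    rewrite big1_seq ?mulr0 ?addr0 // => x /= xin.
    by case: eqP xin yxs => [-> ->|].
  rewrite rmeanD rmeanZ rmean_sum.
  have : \sum_(x <- xs) rmean L (fun y => (y == x)%:R) <= (size xs)%:R * delta :> R.
    apply: le_trans (_ : \sum_(x <- xs) delta <= _); last first.
      by rewrite big_const_seq count_predT iter_addr_0 mulr_natl.
    by apply: ler_sum => x _; exact: Ld.
  have : (size xs)%:R * delta <= (size xs + k.+1)%:R * delta.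
    by rewrite ler_wpM2r // ler_nat leq_addr.
  by move: tp; lra.
apply: le_rmean => y; have [yA|_] := boolP (_ && _); last by rewrite mulr0 mul0r.
by rewrite mulr1 mul1r IH //= addSnnS.
Qed.

(** Once [K] distinct copies are fixed, at most [D] values [z] of the sum of [M] shift all of them
    into [A], and each has mass at most [eta]. The induction moves the copies one at a time into
    [xs], outside the average over [z]. *)
Lemma rmean_distinct_mean_le (R : realType) (V : zmodType) (L M : seq V)
    (A : pred V) (k K D : nat) (xs : seq V) (eta : R) :
  (forall z, pmass M z <= eta) ->
  (forall ys U : seq V, uniq ys -> uniq U -> size ys = K ->
     {in U & ys, forall z y, A (y + z)} -> (size U <= D)%N) ->
  uniq xs -> (k + size xs)%N = K ->
  rmean M (fun z => (all (fun y => A (y + z)) xs)%:R *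
                    distinct_mean L (fun y => A (y + z)) k xs) <= D%:R * eta.
Proof.
move=> Me hA; elim: k xs => [|k IH] xs uxs kK /=.
  have [U [uU UM]] := rmean_supp R V M.
  pose U' := [seq z <- U | all (fun y => A (y + z)) xs].
  rewrite (UM _ (fun z => \sum_(u <- U') (z == u)%:R)); last first.
    move=> z zU; rewrite mulr1; have [zA|zA] := boolP (all _ _).
      rewrite (bigD1_seq z) ?filter_uniq ?mem_filter ?zA ?zU //= eqxx.
      by rewrite big1 ?addr0 // => u; rewrite eq_sym => /negPf ->.
    rewrite big1_seq // => u /= uU'; case: eqP uU' => // <-.
    by rewrite mem_filter (negPf zA).
  rewrite rmean_sum; apply: le_trans (_ : \sum_(u <- U') eta <= _).
    by apply: ler_sum => u _; exact: Me.
  rewrite big_const_seq count_predT iter_addr_0 -[eta *+ _]mulr_natl.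
  rewrite ler_wpM2r ?(le_trans (pmass_ge0 _ _ M 0)) // ler_nat.
  apply: (hA xs) => //; first exact: filter_uniq.
  by move=> z y; rewrite mem_filter => /andP[/allP zA _] /zA.
under eq_rmean => z do rewrite -rmeanZ.
rewrite rmean_exchange -[leRHS](rmean_cst _ _ L); apply: le_rmean => y.
have [yxs|yxs] /= := boolP (y \in xs).
  under eq_rmean => z do rewrite mul0r mulr0.
  by rewrite rmean_cst mulr_ge0 // (le_trans (pmass_ge0 _ _ M 0)).
have := IH (y :: xs); rewrite /= yxs uxs addnS -addSn => /(_ erefl kK).
apply: le_trans; apply: le_rmean => z.
by rewrite mulrA -natrM mulnb andbC.
Qed.

(* A Kővári–Sós–Turán count for the relation y + z \in A between the values y of L
   and z of M, with Jensen replaced by t <= lam + t^(k+1) / lam^k. *)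
Lemma rmean_cat_le (R : realType) (V : zmodType) (L M : seq V)
    (A : pred V) (k D : nat) (delta lam : R) :
  (forall ys U : seq V, uniq ys -> uniq U -> size ys = k.+1 ->
     {in U & ys, forall z y, A (y + z)} -> (size U <= D)%N) ->
  (forall y, pmass L y <= delta) -> (forall z, pmass M z <= lam ^+ k.+1) ->
  0 < lam ->
  rmean (L ++ M) (fun x => (A x)%:R) <= k.+1%:R * delta + (1 + D%:R) * lam.
Proof.
move=> hA Ld Ml lam0; rewrite rmean_cat rmean_exchange.
pose G z : R := distinct_mean L (fun y => A (y + z)) k.+1 [::].
apply: le_trans (_ : rmean M (fun z => (k.+1%:R * delta + lam) + (lam ^+ k)^-1 * G z) <= _).
  apply: le_rmean => z; set p := rmean L _.
  have G0 : 0 <= (lam ^+ k)^-1 * G z.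
    by rewrite mulr_ge0 ?distinct_mean_ge0 // invr_ge0 exprn_ge0 // ltW.
  (* The excess of [p] over the collision loss is the [t] of the inequality replacing Jensen; only
     an excess above [lam] needs the moment. *)
  have [plam|lamp] := leP (p - k.+1%:R * delta) lam; first by lra.
  have t0 : 0 <= p - k.+1%:R * delta by rewrite (le_trans (ltW lam0)) // ltW.
  have : (p - k.+1%:R * delta) ^+ k.+1 <= G z.
    by apply: (distinct_mean_ge _ _ _ _ _ _ delta) => //; rewrite add0n subrK.
  have : p - k.+1%:R * delta <=
      (lam ^+ k)^-1 * (p - k.+1%:R * delta) ^+ k.+1.
    rewrite ler_pdivlMl ?exprn_gt0 // exprSr ler_wpM2r //.
    by rewrite lerXn2r ?nnegrE ?(ltW lam0) ?(ltW lamp).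
  move=> h1 /(ler_wpM2l (_ : 0 <= (lam ^+ k)^-1)).
  rewrite invr_ge0 exprn_ge0 ?(ltW lam0) // => /(_ isT); lra.
rewrite rmeanD rmean_cst rmeanZ.
have := @rmean_distinct_mean_le R V L M A k.+1 k.+1 D [::] _ Ml hA erefl (addn0 _).
under eq_rmean => z do rewrite mul1r.
rewrite -/(rmean M G) => /(ler_wpM2l (_ : 0 <= (lam ^+ k)^-1)).
rewrite invr_ge0 exprn_ge0 ?(ltW lam0) // => /(_ isT).
have -> : (lam ^+ k)^-1 * (D%:R * lam ^+ k.+1) = D%:R * lam.
  by rewrite exprS; field; rewrite expf_neq0 // gt_eqF.
lra.
Qed.

(** * Lower bounds for atoms and the largest atom *)

Lemma pmass_cons_ge (R : realType) (V : zmodType) (L : seq V) (a x : V) :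
  pmass L x / 2 <= pmass (a :: L) (x + a) :> R.
Proof.
rewrite /pmass /= ler_pM2r ?invr_gt0 ?ltr0n //.
rewrite -[leLHS]addr0 lerD //; last by apply: rmean_ge0 => y.
by apply: le_rmean => y; rewrite (inj_eq (addIr a)).
Qed.

Lemma pmassM_le (R : realType) (V : zmodType) (L M : seq V) (x z : V) :
  pmass L x * pmass M z <= pmass (L ++ M) (x + z) :> R.
Proof.
rewrite pmass_cat mulrC -rmeanZ; apply: le_rmean => y.
case: eqP => [->|_]; first by rewrite mulr1 addrC addKr.
by rewrite mulr0 pmass_ge0.
Qed.

(** The maximum over a finite support is attained; starting the search at an atom [x0] of positive
    mass makes it positive, and points off the support have mass 0. *)
Lemma pmass_max (R : realType) (V : zmodType) (L : seq V) :
  exists x : V, 0 < pmass L x :> R /\ forall y, pmass L y <= pmass L x :> R.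
Proof.
have [x0 x0L] : exists x : V, 0 < pmass L x :> R.
  elim: L => [|a L [x xL]]; first by exists 0; rewrite /pmass /= eqxx.
  exists (x + a); apply: lt_le_trans (pmass_cons_ge _ _ _ _ _).
  by rewrite divr_gt0.
have [U [_ UL]] := rmean_supp R V L.
have [x [x0x xU]] : exists x : V, pmass L x0 <= pmass L x :> R /\
    {in U, forall y, pmass L y <= pmass L x :> R}.
  elim: U {UL} => [|u U [x [x0x xU]]]; first by exists x0.
  have [ux|/ltW xu] := leP (pmass L u : R) (pmass L x).
    by exists x; split=> // y /[!inE] /orP[/eqP ->|/xU].
  exists u; split; first exact: le_trans xu.
  by move=> y /[!inE] /orP[/eqP ->//|/xU yx]; exact: le_trans xu.
exists x; split=> [|y]; first exact: lt_le_trans x0x.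
have [/xU//|yU] := boolP (y \in U).
rewrite /pmass (UL _ (fun=> 0)) ?rmean_cst ?pmass_ge0 // => z zU.
by case: eqP zU yU => [->->|].
Qed.

(* Each step at most halves the largest atom. *)
Lemma exists_prefix_pmass (R : realType) (V : zmodType) (L : seq V) (r : R) :
  r < 1 -> (forall x, pmass L x <= r) ->
  exists L1 L2, [/\ L = L1 ++ L2, forall x, pmass L1 x <= r &
                    exists x, r / 2 <= pmass L1 x].
Proof.
move=> r1; elim/last_ind: L => [|L a IH] Lr.
  by have := Lr 0; rewrite /pmass /= eqxx leNgt r1.
have [|/existsNP[x /negP]] := pselect (forall x, pmass L x <= r).
  move=> /IH [L1 [L2 [-> L1r L1x]]]; exists L1, (rcons L2 a).
  by rewrite rcons_cat.
rewrite -ltNge => rx; exists (rcons L a), [::]; split=> //; first by rewrite cats0.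
exists (x + a); have -> : pmass (rcons L a) (x + a) = pmass (a :: L) (x + a) :> R.
  by apply: perm_pmass; rewrite perm_rcons.
have := pmass_cons_ge R V L a x; lra.
Qed.

(** * Sets with the generic intersection property *)

(** With translation vectors [y + p] for [y] in [ys], every [z] in [U] lies in all the translates.
    Lists without repetition are what the counting of atoms uses. *)
Lemma generic_intersection_size (R : realType) (d : nat) (S : set 'rV[R]_d) :
  generic_intersection S ->
  exists D : nat, forall (p : 'rV[R]_d) (W : {vspace 'rV[R]_d}),
    (0 < \dim W)%N -> forall ys U : seq 'rV[R]_d,
    uniq ys -> uniq U -> size ys = \dim W ->
    {in U & ys, forall z y, `[< S (y + z + p) >] && (y + z \in W)} ->
    (size U <= D)%N.
Proof.
move=> [D hD]; exists D => p W W0 ys U uys uU sys hU.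
pose x (i : 'I_(\dim W)) := nth 0 ys i + p.
have ix : injective x.
  move=> i j /addIr /eqP; rewrite nth_uniq ?sys // => /eqP.
  exact: val_inj.
have UI : (nth 0 U @` `I_(size U) #= `I_(size U))%card.
  apply: inj_card_eq => i j /[!inE] /= iU jU /eqP.
  by rewrite nth_uniq // => /eqP.
rewrite -card_le_II -(card_le_eql UI).
apply: card_le_trans (hD p W W0 x ix); apply: subset_card_le => _ [l /= lU <-] i _.
have zU := mem_nth 0 lU; set z := nth 0 U l in zU *.
exists (z + x i); last by rewrite addrK.
have yys : nth 0 ys i \in ys by rewrite mem_nth ?sys.
have := hU _ _ zU yys.
rewrite /x /affine_subspace /= addrCA addrA addrK => /andP[/asboolP Szp zW].
by split.
Qed.

Lemma rmean_pred_le1 (R : realType) (V : zmodType) (L : seq V) (A : pred V) :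
  rmean L (fun x => (A x)%:R) <= 1 :> R.
Proof.
rewrite -[leRHS](rmean_cst R V L); apply: le_rmean => x.
by case: (A x).
Qed.

(** The constant is uniform in [p], which absorbs the signs exposed before the induction hypothesis
    is applied. With the square root as a factor, the empty list is no exception. *)
Lemma rmean_generic_le_sqrt (R : realType) (d D : nat) (S : set 'rV[R]_d) :
  (forall (p : 'rV[R]_d) (W : {vspace 'rV[R]_d}),
    (0 < \dim W)%N -> forall ys U : seq 'rV[R]_d,
    uniq ys -> uniq U -> size ys = \dim W ->
    {in U & ys, forall z y, `[< S (y + z + p) >] && (y + z \in W)} ->
    (size U <= D)%N) ->
  forall k : nat, exists2 C : R, 0 <= C & forall (L : seq 'rV[R]_d) p,
    (\dim <<L>> <= k)%N -> 0 \notin L ->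
    Num.sqrt (size L)%:R * rmean L (fun x => `[< S (x + p) >]%:R) <= C.
Proof.
move=> hD; elim=> [|k [C C0 IH]].
  exists 0 => // L p; rewrite leqn0 dimv_eq0 => /eqP L0.
  case: L L0 => [|a L] L0; first by rewrite sqrtr0 mul0r.
  have : a \in <<a :: L>>%VS by rewrite memv_span ?mem_head.
  by rewrite L0 memv0 inE eq_sym => ->.
(* Two families of [2 ^ s.+1] bases use [4 * 2 ^ s * k.+1] vectors; the factor 8 makes this at most
   half of [L]. *)
set K := (8 * k.+1)%N.
exists (2 * C + (k.+2 + D)%:R * Num.sqrt K%:R).
  by rewrite addr_ge0 ?mulr_ge0 ?sqrtr_ge0 ?ler0n.
move=> L p dL L0; set f := fun x => _.
have rest0 : 0 <= (k.+2 + D)%:R * Num.sqrt K%:R :> R.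
  by rewrite mulr_ge0 ?sqrtr_ge0 ?ler0n.
move: dL; rewrite leq_eqVlt => /orP[/eqP dL|dL]; last first.
  by have := IH L p dL L0; rewrite -/f; lra.
have [nK|Kn] := ltnP (size L) K.
  have : Num.sqrt (size L)%:R * rmean L f <= Num.sqrt K%:R * 1.
    by rewrite ler_pM ?sqrtr_ge0 ?rmean_pred_le1 ?rmean_ge0 ?ler_wsqrtr ?ler_nat ?(ltnW nK).
  have : Num.sqrt K%:R * 1 <= (k.+2 + D)%:R * Num.sqrt K%:R :> R.
    by rewrite mulrC ler_wpM2r ?sqrtr_ge0 // ler1n.
  lra.
(* The lower bound [sL] on the size serves the count of vectors left in [N], the upper bound [Ls]
   turns [lam] into a multiple of the inverse square root of the size. *)
pose s := trunc_log 2 (size L %/ K).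
have sL : (2 ^ s * K <= size L)%N.
  apply: leq_trans (leq_divM _ K); rewrite leq_mul2r trunc_logP ?orbT //.
  by rewrite divn_gt0.
have Ls : (size L < 2 ^ s.+1 * K)%N.
  by rewrite -ltn_divLR //; exact: trunc_log_ltn.
have [[Bs [M [pL sBs hBs]]]|[M [N [pL sM dN]]]] :=
    perm_bases_or_low_dim R _ _ (2 ^ s.+1 + 2 ^ s.+1) _ dL.
  set lam : R := Num.sqrt (2 ^ s.+1)%:R^-1.
  have lam0 : 0 < lam by rewrite sqrtr_gt0 invr_gt0 ltr0n expn_gt0.
  have lam1 : lam <= 1.
    rewrite -[leRHS]sqrtr1 ler_wsqrtr // invf_le1 ?ltr0n ?expn_gt0 //.
    by rewrite ler1n expn_gt0.
  have lam2 : (2 ^ s.+1)%:R^-1 <= lam ^+ 2 by rewrite sqr_sqrtr ?invr_ge0.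
  set B1 := take (2 ^ s.+1) Bs; set B2 := drop (2 ^ s.+1) Bs.
  have sB2 : size B2 = (2 ^ s.+1)%N by rewrite size_drop sBs addnK.
  have sB1 : size B1 = (2 ^ s.+1)%N by rewrite size_takel // sBs leq_addr.
  have mass1 x : pmass (flatten B1) x <= lam ^+ k.+1.
    apply: (pmass_flatten_bases _ _ _ s) => // [B /mem_take|]; first exact: hBs.
    exact: ltW.
  have mass2 x : pmass (flatten B2) x <= lam ^+ k.+1.
    apply: (pmass_flatten_bases _ _ _ s) => // [B /mem_drop|]; first exact: hBs.
    exact: ltW.
  have BL : {subset flatten B1 ++ flatten B2 <= <<L>>%VS}.
    rewrite -flatten_cat cat_take_drop => x xB; apply: memv_span.
    by rewrite (perm_mem pL) mem_cat xB.
  (* Exposing the sum [x] of the leftover vectors moves the affine subspace to [p + x + <<L>>]. The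
     other vectors stay in its direction, so membership can be added to the event. *)
  have mean x : rmean (flatten B1 ++ flatten B2) (fun y => f (x + y)) <=
      (k.+2 + D)%:R * lam.
    rewrite (rmean_span _ _ <<L>>%VS _ _
      (fun y => (`[< S (y + (p + x)) >] && (y \in <<L>>%VS))%:R) BL); last first.
      by move=> y yL; rewrite yL andbT /f [x + y + p]addrC [p + (x + y)]addrA [p + x + y]addrC.
    apply: le_trans (rmean_cat_le _ _ _ _ _ k D _ lam _ mass1 mass2 lam0) _.
      move=> ys U uys uU sys; rewrite -dL in sys; apply: (hD (p + x) <<L>>%VS) => //.
      by rewrite dL.
    have : lam ^+ k.+1 <= lam by rewrite exprS ler_piMr ?exprn_ile1 ?(ltW lam0).
    move=> /(ler_wpM2l (_ : 0 <= k.+1%:R)) => /(_ (ler0n _ _)).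
    rewrite natrD (mulrSr _ k.+1); lra.
  have : rmean L f <= (k.+2 + D)%:R * lam.
    rewrite (perm_rmean _ _ _ _ _ pL) -(cat_take_drop (2 ^ s.+1) Bs) flatten_cat.
    rewrite rmean_catC rmean_cat -[leRHS](rmean_cst _ _ M).
    by apply: le_rmean => x; exact: mean.
  move=> /(ler_wpM2l (sqrtr_ge0 (size L)%:R)).
  have : Num.sqrt (size L)%:R * lam <= Num.sqrt K%:R.
    rewrite -sqrtrM // ler_wsqrtr // ler_pdivrMr ?ltr0n ?expn_gt0 //.
    by rewrite -natrM ler_nat mulnC ltnW.
  move=> /(ler_wpM2l (_ : 0 <= (k.+2 + D)%:R)); rewrite ler0n => /(_ isT).
  rewrite mulrCA; lra.
(* In fact [N] keeps at least half of the vectors; the weaker 4 has the integer square root 2 found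
   in [2 * C]. *)
have sN : (size L <= 4 * size N)%N.
  move: sM sL; rewrite (perm_size pL) size_cat /K expnS.
  move: (2 ^ s)%N (size M) (size N) => q u v; nia.
have : rmean L (fun x => Num.sqrt (size L)%:R * f x) <= 2 * C.
  rewrite (perm_rmean _ _ _ _ _ pL) rmean_cat -[leRHS](rmean_cst _ _ M).
  apply: le_rmean => x; rewrite rmeanZ.
  have N0 : 0 \notin N.
    by apply: contra L0; rewrite (perm_mem pL) mem_cat orbC => ->.
  have := IH N (x + p) dN N0.
  rewrite (eq_rmean _ _ _ _ (fun y => f (x + y))); last first.
    by move=> y; rewrite /f addrA [y + x]addrC.
  have : Num.sqrt (size L)%:R <= 2 * Num.sqrt (size N)%:R :> R.
    have -> : 2 = Num.sqrt (2 ^+ 2) :> R by rewrite sqrtr_sqr ger0_norm.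
    rewrite -sqrtrM ?exprn_ge0 // ler_wsqrtr // -natrX -natrM ler_nat.
    exact: sN.
  have : 0 <= rmean N (fun y => f (x + y)) by apply: rmean_ge0.
  by move=> /ler_wpM2r h /h; lra.
by rewrite rmeanZ; lra.
Qed.

(** The space has dimension [d.+1], and [r] stands for the root of order [d.+2] of the largest atom,
    so that only integer powers occur. *)
Lemma rmean_generic_le_pmass (R : realType) (d D : nat) (S : set 'rV[R]_d.+1) :
  (forall (p : 'rV[R]_d.+1) (W : {vspace 'rV[R]_d.+1}),
    (0 < \dim W)%N -> forall ys U : seq 'rV[R]_d.+1,
    uniq ys -> uniq U -> size ys = \dim W ->
    {in U & ys, forall z y, `[< S (y + z + p) >] && (y + z \in W)} ->
    (size U <= D)%N) ->
  forall (L : seq 'rV[R]_d.+1) (r : R), 0 < r ->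
    (forall x, pmass L x <= r ^+ d.+2) ->
    rmean L (fun x => `[< S x >]%:R) <= (d.+1%:R + (1 + D%:R) * 2) * r.
Proof.
move=> hD L r r0 Lr.
have D0 : 0 <= D%:R :> R by exact: ler0n.
have d1 : 1 <= d.+1%:R :> R by rewrite ler1n.
(* For [r >= 1] the bound exceeds 1; the prefix lemma requires [r < 1]. *)
have [r1|r1] := leP 1 r.
  by apply: le_trans (rmean_pred_le1 _ _ _ _) _; nra.
have Lr' x : pmass L x <= r.
  by apply: le_trans (Lr x) _; rewrite exprS ler_piMr ?exprn_ile1 ?(ltW r0) ?(ltW r1).
have [L1 [L2 [LE L1r [x rx]]]] := exists_prefix_pmass R _ L r r1 Lr'.
(* An atom of [L1] of mass at least [r / 2] gives [2 * r ^+ d.+1], weakened to a pure power so that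
   [lam] can be [2 * r]. *)
have L2r z : pmass L2 z <= (2 * r) ^+ d.+1.
  have : r / 2 * pmass L2 z <= r ^+ d.+2.
    apply: le_trans (Lr (x + z)); rewrite LE.
    by apply: le_trans (pmassM_le _ _ _ _ _ _); rewrite ler_wpM2r ?pmass_ge0.
  rewrite exprS -mulrA ler_pM2l // ler_pdivrMl // => /le_trans; apply.
  by rewrite exprMn ler_wpM2r ?exprn_ge0 ?(ltW r0) // exprS ler_peMr // exprn_ege1 // ler1n.
have dimE : \dim {: 'rV[R]_d.+1} = d.+1.
  by rewrite dimvf dim_matrix mul1r.
rewrite LE; apply: le_trans (rmean_cat_le _ _ _ _ _ d D r (2 * r) _ L1r L2r _) _.
- move=> ys U uys uU sys hU; apply: (hD 0 {: 'rV[R]_d.+1}%VS _ ys U); rewrite ?dimE //.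
  by move=> z y zU yys; rewrite addr0 memvf andbT; exact: hU.
- by rewrite mulr_gt0.
- by rewrite [leRHS]mulrDl -[_ * 2 * r]mulrA.
Qed.

(** * Passage to random variables *)

(* The signs of the indices in J have already been exposed, with values c. *)
Lemma probability_signed_sum (R : realType) (V : lmodType R) (n : nat)
    (a : 'I_n -> V) (dsp : measure_display) (T : measurableType dsp)
    (P : probability T R) (xi : 'I_n -> {RV P >-> R}) :
  (forall i, rademacher (xi i)) -> mutually_independent xi ->
  forall (l : seq 'I_n) (J : {set 'I_n}) (c : 'I_n -> R) (A : set V),
  (forall j, c j = 1 \/ c j = -1) -> uniq l -> {in l, forall i, i \notin J} ->
  let E := [set t | A (\sum_(i <- l) xi i t *: a i)] `&`
           \bigcap_(i in [set` J]) (xi i @^-1` [set c i]) in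
  measurable E /\
  P E = ((2^-1) ^+ #|J| * rmean (map a l) (fun x => `[< A x >]%:R))%:E.
Proof.
move=> hrad hind; elim=> [|i l IH] J c A hc /=.
  move=> _ _; set F := \bigcap_(_ in _) _.
  have mF : measurable F.
    exact: fin_bigcap_measurable.
  have PF : P F = ((2^-1) ^+ #|J|)%:E.
    rewrite /F (hind J (fun i => [set c i])) //.
    rewrite (eq_bigr (fun=> (2^-1)%:E)); last first.
      by move=> i _; have [_ h1 h2] := hrad i; case: (hc i) => ->.
    by rewrite prodEFin prodr_const.
  have [A0|A0] := pselect (A 0).
    have -> : [set t | A (\sum_(i <- [::]) xi i t *: a i)] = setT.
      by apply/seteqP; split => // t _ /=; rewrite big_nil.
    by rewrite setTI PF (asboolT A0) mulr1.
  have -> : [set t | A (\sum_(i <- [::]) xi i t *: a i)] = set0.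
    by apply/seteqP; split => // t /=; rewrite big_nil.
  by rewrite set0I measure0 (asboolF A0) mulr0.
move=> /andP[il ul] lJ; set F := \bigcap_(_ in _) _.
have iJ : i \notin J by apply: lJ; rewrite mem_head.
(* The sign of [i] is exposed with value [e] and its term moves into the event, matching one step of
   the recursion of [rmean]; the additional factor [2^-1] is the division by 2 there. *)
pose cc e j := if j == i then e else c j.
pose G e := [set t | A (\sum_(j <- l) xi j t *: a j + e *: a i)] `&`
   \bigcap_(j in [set` (i |: J)%SET]) (xi j @^-1` [set cc e j]).
have lJ' : {in l, forall j, j \notin (i |: J)%SET}.
  move=> j jl; rewrite in_setU1 negb_or lJ ?inE ?jl ?orbT // andbT.
  by apply: contraNneq il => <-.
have hG e : e = 1 \/ e = -1 -> measurable (G e) /\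
    P (G e) = ((2^-1) ^+ #|J|.+1 *
       rmean (map a l) (fun x => `[< A (x + e *: a i) >]%:R))%:E.
  move=> he; have := IH (i |: J)%SET (cc e) [set x | A (x + e *: a i)] _ ul lJ'.
  rewrite cardsU1 iJ; apply.
  by move=> j; rewrite /cc; case: ifP.
have GE e t : G e t <-> [/\ xi i t = e, F t & A (\sum_(j <- i :: l) xi j t *: a j)].
  rewrite /G /F /= big_cons; split.
    move=> [At tJ]; have ti : xi i t = e.
      by have /= := tJ i; rewrite in_setU1 eqxx /cc eqxx; apply.
    split=> //; last by rewrite ti addrC.
    move=> j /= jJ; have /= := tJ j; rewrite in_setU1 jJ orbT /cc.
    by case: eqP jJ iJ => [-> ->//|_ _ _]; apply.
  move=> [ti tF At]; split; first by rewrite -ti addrC.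
  move=> j /=; rewrite in_setU1 /cc => /orP[/eqP ->|jJ]; first by rewrite eqxx.
  by case: eqP jJ iJ => [-> ->//|_ jJ _]; exact: tF.
have -> : [set t | A (\sum_(j <- i :: l) xi j t *: a j)] `&` F = G 1 `|` G (-1).
  apply/seteqP; split => t /=.
    move=> [At Ft]; have [xi1 _ _] := hrad i.
    by case: (xi1 t) => ?; [left|right]; apply/GE.
  by case=> /GE[].
have [m1 P1] := hG 1 (or_introl erefl).
have [m2 P2] := hG (-1) (or_intror erefl).
split; first exact: measurableU.
rewrite measureU //.
  apply: (etrans (congr2 adde P1 P2)); rewrite -[LHS]EFinD; congr (_%:E).
  under eq_rmean => x do rewrite scale1r.
  under [X in _ + _ * X]eq_rmean => x do rewrite scaleN1r.
  by rewrite exprSr; field.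
apply/seteqP; split => // t [/GE[e1 _ _] /GE[e2 _ _]].
by move: e2; rewrite e1 => /eqP; rewrite -subr_eq0 opprK -[1 + 1]/(2%:R) pnatr_eq0.
Qed.

Lemma probability_rv_comb (R : realType) (d n : nat) (a : 'I_n -> 'rV[R]_d)
    (dsp : measure_display) (T : measurableType dsp) (P : probability T R)
    (xi : 'I_n -> {RV P >-> R}) (A : set 'rV[R]_d) :
  (forall i, rademacher (xi i)) -> mutually_independent xi ->
  P [set t | A (rv_comb a xi t)] =
  (rmean (map a (enum 'I_n)) (fun x => `[< A x >]%:R))%:E.
Proof.
move=> hrad hind.
have [] := probability_signed_sum R _ n a dsp T P xi hrad hind (enum 'I_n)
  finset.set0 (fun=> 1) A (fun=> or_introl erefl) (enum_uniq _) _.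
  by move=> i _; rewrite finset.in_set0.
move=> _; rewrite cards0 expr0 mul1r => <-; congr (P _).
apply/seteqP; split => t /=; rewrite /rv_comb big_enum //=.
  by move=> At; split => // i /=; rewrite finset.in_set0.
by case.
Qed.

Theorem theorem1p8 (R : realType) (d : nat) (S : set 'rV[R]_d)
    (hS : generic_intersection S) :
  exists C : R,
    forall (n : nat) (a : 'I_n -> 'rV[R]_d)
      (dsp : measure_display) (T : measurableType dsp) (P : probability T R)
      (xi : 'I_n -> {RV P >-> R}),
    (0 < n)%N ->
    (forall i, a i != 0) ->
    (forall i, rademacher (xi i)) ->
    mutually_independent xi ->
    let X := rv_comb a xi in
    (P [set t | S (X t)] <= (C * n%:R `^ (- 2^-1))%:E)%E /\
    exists rho : R,
      is_maximum (range (fun x => P [set t | X t = x])) rho%:E /\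
      (P [set t | S (X t)] <= (C * rho `^ (d.+1%:R)^-1)%:E)%E.
Proof.
case: d S hS => [|d] S hS.
  (* In dimension 0 every vector vanishes, which contradicts [a i != 0] as [n] is positive. *)
  exists 0 => n a dsp T P xi n0 /(_ (Ordinal n0)) /eqP[].
  by apply/rowP => -[].
have [D hD] := generic_intersection_size _ _ _ hS.
have [C1 C10 hC1] := rmean_generic_le_sqrt _ _ _ _ hD d.+1.
have hC2 := rmean_generic_le_pmass _ _ _ _ hD.
set C2 := d.+1%:R + _ in hC2.
have C20 : 0 <= C2 by rewrite addr_ge0 ?mulr_ge0 ?addr_ge0 ?ler0n.
exists (C1 + C2) => n a dsp T P xi n0 a0 hrad hind X.
set L := map a (enum 'I_n).
have PX A : P [set t | A (X t)] = (rmean L (fun x => `[< A x >]%:R))%:E.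
  exact: probability_rv_comb.
have PX1 x : P [set t | X t = x] = (pmass L x)%:E.
  rewrite (PX (fun y => y = x)); congr (_%:E); apply: eq_rmean => y.
  by case: eqP => [yx|/asboolF -> //]; rewrite asboolT.
have szL : size L = n by rewrite size_map size_enum_ord.
rewrite PX; split.
  rewrite lee_fin powRN powR12_sqrt ?ler0n //.
  rewrite ler_pdivlMr ?sqrtr_gt0 ?ltr0n // mulrC.
  apply: le_trans (_ : C1 <= _); last by rewrite lerDl.
  have := hC1 L 0; rewrite szL.
  under eq_rmean => x do rewrite addr0.
  apply; first by rewrite (leq_trans (dimvS (subvf _))) // dimvf dim_matrix mul1r.
  by apply/mapP => -[i _ /esym/eqP]; rewrite (negPf (a0 i)).
have [x [x0 xmax]] := pmass_max R _ L.
exists (pmass L x); split.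
  split; first by exists x.
  by move=> _ [y _ <-]; rewrite PX1 lee_fin.
(* The dimension is now [d.+1], so the exponent is the inverse of [d.+2] and [r ^+ d.+2] is the
   largest atom. *)
set r := _ `^ _; have r0 : 0 < r by exact: powR_gt0.
rewrite lee_fin; apply: le_trans (hC2 L r r0 _) _.
  move=> y; rewrite -powR_mulrn ?(ltW r0) // -powRrM mulVf ?pnatr_eq0 //.
  by rewrite powRr1 ?(ltW x0).
by rewrite ler_wpM2r ?(ltW r0) // lerDr.
Qed.
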